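(* Let $F/B$ and $F'/B'$ be field extensions, let $T$ be the set of all functions $F^n\to F$, $(a_1,\dots,a_n)\mapsto f(a_1,\dots,a_n)$, with $n\in\mathbb{Z}^+$ and $f\in B[x_1,\dots,x_n]$, and let $T'$ be defined in the same way from $F'$ and $B'$. Let $\varphi:B\to B'$ be a field isomorphism, and let $$\vartheta:\bigcup_{n\in\mathbb{Z}^+}B[x_1,\dots,x_n]\to\bigcup_{n\in\mathbb{Z}^+}B'[x_1,\dots,x_n]$$ be the map that sends $f=\sum c_{p_1,\dots,p_n}x_1^{p_1}\cdots x_n^{p_n}$ to $\sum\varphi(c_{p_1,\dots,p_n})x_1^{p_1}\cdots x_n^{p_n}$. Let $$\theta=\{(\tau(f),\tau'(\vartheta(f))): f\in B[x_1,\dots,x_n],\ n\in\mathbb{Z}^+\},$$ where $\tau$ sends $f\in B[x_1,\dots,x_n]$ to the function $F^n\to F$ it induces, and $\tau'$ sends $f\in B'[x_1,\dots,x_n]$ to the function $F'^n\to F'$ it induces. Then for all nonempty $U\subseteq F$ and nonempty $V\subseteq F'$, a map $\phi:\langle U\rangle_T\to\langle V\rangle_{T'}$ is a ring homomorphism extending $\varphi$ if and only if $\phi$ is a $\theta$-morphism.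
   Context: An operator gen-semigroup on a set $D$ is a set $T$ of functions $D^n\to D$ ($n\in\mathbb{Z}^+$ arbitrary) such that for every $n$-variable $f\in T$ and all $g_1,\dots,g_n\in T$ ($g_i$ of $n_i$ variables), the composite $f\circ(g_1,\dots,g_n):D^{n_1+\cdots+n_n}\to D$, obtained by substituting $g_1,\dots,g_n$, evaluated on consecutive disjoint blocks of variables, into $f$, lies in $T$. Both $T$ and $T'$ in the claim are operator gen-semigroups. For $U\subseteq D$, $\langle U\rangle_T=\{f(u_1,\dots,u_n): n\in\mathbb{Z}^+, f\in T\text{ of }n\text{ variables}, u_i\in U\}$; such sets are called $T$-spaces (in the claim, $\langle U\rangle_T=B[U]$ and $\langle V\rangle_{T'}=B'[V]$). For operator gen-semigroups $T_1,T_2$ and a relation $\theta\subseteq T_1\times T_2$, and $f\in\operatorname{Dom}\theta$, the expression $\theta(f)(b_1,\dots,b_n)$ is well-defined if every $g$ with $(f,g)\in\theta$ has $n$ variables and all such $g$ take the same value at $(b_1,\dots,b_n)$; $\theta(f)(b_1,\dots,b_n)$ is then that value. A map $\phi$ from a $T_1$-space $S$ to a $T_2$-space is a $\theta$-morphism if for all $n\in\mathbb{Z}^+$, $(a_1,\dots,a_n)\in S^n$ and $f\in\operatorname{Dom}\theta$ of $n$ variables, $\theta(f)(\phi(a_1),\dots,\phi(a_n))$ is well-defined and $\phi(f(a_1,\dots,a_n))=\theta(f)(\phi(a_1),\dots,\phi(a_n))$. Polynomials are regarded together with their number $n$ of variables. *)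

(* Defs.v *)
From HB Require Import structures.
From mathcomp Require Import all_boot all_order all_algebra.
From mathcomp Require Import boolp classical_sets.
From mathcomp Require Import mpoly.

Set Implicit Arguments.
Unset Strict Implicit.
Unset Printing Implicit Defensive.

Import GRing.Theory.

Local Open Scope classical_set_scope.
Local Open Scope ring_scope.

Record operator (D : Type) := Operator {
  arity : nat;
  arity_gt0 : (0 < arity)%N;
  opfun :> ('I_arity -> D) -> D
}.

Lemma opcomp_arity_gt0 (D : Type) (f : operator D)
    (g : 'I_(arity f) -> operator D) : (0 < \sum_i arity (g i))%N.
Proof.
case: f g => n n0 f /= g; rewrite (bigD1 (Ordinal n0)) //=.
by rewrite addn_gt0 arity_gt0.
Qed.

(* [tagnat.Rank i j] is the index of the [j]-th variable of the [i]-th of the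
   consecutive blocks of lengths [arity (g 0)], [arity (g 1)], etc. *)
Definition opcomp (D : Type) (f : operator D)
    (g : 'I_(arity f) -> operator D) : operator D :=
  Operator (opcomp_arity_gt0 g)
    (fun x => f (fun i => g i (fun j => x (tagnat.Rank i j)))).

Record genSemigroup (D : Type) := GenSemigroup {
  gsops :> set (operator D);
  gs_comp : forall (f : operator D) (g : 'I_(arity f) -> operator D),
    gsops f -> (forall i, gsops (g i)) -> gsops (opcomp g)
}.

Definition tspan (D : Type) (T : genSemigroup D) (U : set D) : set D :=
  [set x | exists (f : operator D) (u : 'I_(arity f) -> D),
     [/\ gsops T f, forall i, U (u i) & x = f u]].

Lemma tspan_closed (D : Type) (T : genSemigroup D) (U : set D)
    (f : operator D) (a : 'I_(arity f) -> D) :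
  gsops T f -> (forall i, tspan T U (a i)) -> tspan T U (f a).
Proof.
move=> Tf aU.
have /choice [gu hgu] : forall i,
    exists gu : {g : operator D & 'I_(arity g) -> D},
    [/\ gsops T (tag gu), forall j, U (tagged gu j) & a i = tag gu (tagged gu)].
  by move=> i; have [g [u h]] := aU i; exists (Tagged _ u).
pose p_ i := arity (tag (gu i)).
pose u (k : 'I_(\sum_i p_ i)) : D :=
  tagged (gu (tag (tagnat.sig k))) (tagged (tagnat.sig k)).
exists (opcomp (fun i => tag (gu i))), u; split.
- by apply: gs_comp => [|i] /=; [exact: Tf | case: (hgu i)].
- by move=> k; rewrite /u; case: (hgu (tag (tagnat.sig k))).
rewrite /=; congr (@opfun _ f _); apply/funext => i; have [_ _ ->] := hgu i.
congr (@opfun _ _ _); apply/funext => j.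
by rewrite /u /tagnat.Rank tagnat.rankK.
Qed.

Definition tact (D : Type) (T : genSemigroup D) (U : set D) (f : operator D)
    (Tf : gsops T f) (a : 'I_(arity f) -> tspan T U) : tspan T U :=
  exist _ (f (fun i => val (a i)))
    (mem_set (tspan_closed Tf (fun i => set_mem (valP (a i))))).

Record opRel (D1 D2 : Type) (T1 : genSemigroup D1) (T2 : genSemigroup D2) :=
  OpRel {
    relset :> set (operator D1 * operator D2);
    relset_sub : relset `<=` T1 `*` T2
  }.

Definition Dom (D1 D2 : Type) (T1 : genSemigroup D1) (T2 : genSemigroup D2)
    (theta : opRel T1 T2) : set (operator D1) :=
  [set f | exists g, relset theta (f, g)].

Definition app_cast (D : Type) (g : operator D) (n : nat) (e : arity g = n)
    (b : 'I_n -> D) : D :=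
  g (fun i => b (cast_ord e i)).

Definition rel_well_defined (D1 D2 : Type) (T1 : genSemigroup D1)
    (T2 : genSemigroup D2) (theta : opRel T1 T2) (f : operator D1)
    (b : 'I_(arity f) -> D2) : Prop :=
  (forall g, relset theta (f, g) -> arity g = arity f) /\
  (forall g g' (e : arity g = arity f) (e' : arity g' = arity f),
     relset theta (f, g) -> relset theta (f, g') -> app_cast e b = app_cast e' b).

(* [v] is the value theta(f)(b); it is unique when theta(f)(b) is
   well-defined. *)
Definition is_rel_value (D1 D2 : Type) (T1 : genSemigroup D1)
    (T2 : genSemigroup D2) (theta : opRel T1 T2) (f : operator D1)
    (b : 'I_(arity f) -> D2) (v : D2) : Prop :=
  exists (g : operator D2) (e : arity g = arity f),
    relset theta (f, g) /\ app_cast e b = v.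

Definition theta_morphism (D1 D2 : Type) (T1 : genSemigroup D1)
    (T2 : genSemigroup D2) (theta : opRel T1 T2) (U : set D1) (V : set D2)
    (phi : tspan T1 U -> tspan T2 V) : Prop :=
  forall (f : operator D1) (Tf : gsops T1 f) (a : 'I_(arity f) -> tspan T1 U),
    Dom theta f ->
    let b i := val (phi (a i)) in
    rel_well_defined theta b /\ is_rel_value theta b (val (phi (tact Tf a))).

Section PolynomialOperators.
Variables (B F : fieldType) (iota : {rmorphism B -> F}).

(* The function F^n -> F induced by p, where B is embedded in F by iota. *)
Definition tau (n : nat) (n0 : (0 < n)%N) (p : {mpoly B[n]}) : operator F :=
  Operator n0 (fun a : 'I_n -> F => mmap iota a p).

Definition polyOps_set : set (operator F) :=
  [set f | exists (n : nat) (n0 : (0 < n)%N) (p : {mpoly B[n]}), f = tau n0 p].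

Lemma mmap_mmap (n k : nat) (h : 'I_k -> F) (q : 'I_n -> {mpoly B[k]})
    (p : {mpoly B[n]}) :
  mmap iota h (mmap (@mpolyC k B) q p)
  = mmap iota (fun i => mmap iota h (q i)) p.
Proof.
rewrite [X in mmap iota h X]/mmap rmorph_sum /= [RHS]/mmap; apply: eq_bigr => m _.
rewrite rmorphM /= mmapC; congr (_ * _).
by rewrite /mmap1 rmorph_prod; apply: eq_bigr => i _; rewrite rmorphXn.
Qed.

Lemma polyOps_comp (f : operator F) (g : 'I_(arity f) -> operator F) :
  polyOps_set f -> (forall i, polyOps_set (g i)) -> polyOps_set (opcomp g).
Proof.
move=> [n [n0 [p ef]]]; rewrite ef in g * => pg; clear ef f.
rewrite /= in g pg *.
have pg' i : exists q : {mpoly B[arity (g i)]},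
    forall a, g i a = mmap iota a q.
  by have [k [k0 [q ->]]] := pg i; exists q.
pose q i := sval (cid (pg' i)).
have hq i : forall a, g i a = mmap iota a (q i) := svalP (cid (pg' i)).
exists _, (@opcomp_arity_gt0 _ (tau n0 p) g).
pose lift i := mmap (@mpolyC (\sum_i arity (g i)) B)
  (fun j => 'X_(tagnat.Rank i j)) (q i).
exists (mmap (@mpolyC _ B) lift p).
rewrite /opcomp /tau; congr (Operator _ _); apply/funext => x /=.
rewrite mmap_mmap; congr (mmap _ _ _); apply/funext => i.
rewrite hq mmap_mmap; congr (mmap _ _ _); apply/funext => j.
by rewrite mmapX mmap1U.
Qed.

Definition polyOps : genSemigroup F := GenSemigroup polyOps_comp.

Lemma tspan_subring_closed (U : set F) :
  U !=set0 -> subring_closed (mem (tspan polyOps U)).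
Proof.
have const c : U !=set0 -> tspan polyOps U (iota c).
  case=> u Uu; exists (tau (ltn0Sn 0) c%:MP), (fun=> u); split=> //=.
    by exists 1, (ltn0Sn 0), c%:MP.
  by rewrite mmapC.
have bin (p : {mpoly B[2]}) x y : tspan polyOps U x -> tspan polyOps U y ->
    tspan polyOps U (mmap iota (fun i : 'I_2 => if val i == 0%N then x else y) p).
  move=> Ux Uy; apply: (@tspan_closed _ polyOps U (tau (ltn0Sn 1) p)).
    by exists 2, (ltn0Sn 1), p.
  by move=> i /=; case: ifP.
move=> Un0; split.
- by rewrite inE -(rmorph1 iota); exact: const.
- move=> x y; rewrite !inE => Ux Uy.
  by have := bin ('X_0 - 'X_1) _ _ Ux Uy; rewrite mmapB !mmapX !mmap1U.
- move=> x y; rewrite !inE => Ux Uy.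
  by have := bin ('X_0 * 'X_1) _ _ Ux Uy; rewrite rmorphM /= !mmapX !mmap1U.
Qed.

(* B[U]; the proof that U is nonempty is needed for the ring structure. *)
Definition polySpace (U : set F) (U0 : U !=set0) : Type := tspan polyOps U.

HB.instance Definition _ (U : set F) (U0 : U !=set0) :=
  SubChoice.on (polySpace U0).
HB.instance Definition _ (U : set F) (U0 : U !=set0) :=
  GRing.SubChoice_isSubComNzRing.Build F (mem (tspan polyOps U)) (polySpace U0)
    (tspan_subring_closed U0).
End PolynomialOperators.

Section Theta.
Variables (B F B' F' : fieldType).
Variables (iota : {rmorphism B -> F}) (iota' : {rmorphism B' -> F'}).
Variable varphi : {rmorphism B -> B'}.

Definition vartheta (n : nat) (p : {mpoly B[n]}) : {mpoly B'[n]} :=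
  map_mpoly varphi p.

Definition theta_set : set (operator F * operator F') :=
  [set fg | exists (n : nat) (n0 : (0 < n)%N) (p : {mpoly B[n]}),
     fg = (tau iota n0 p, tau iota' n0 (vartheta p))].

Lemma theta_sub : theta_set `<=` polyOps iota `*` polyOps iota'.
Proof.
by move=> _ [n [n0 [p ->]]]; split; [exists n, n0, p|exists n, n0, (vartheta p)].
Qed.

Definition theta : opRel (polyOps iota) (polyOps iota') := OpRel theta_sub.
End Theta.

Definition ring_hom (R S : comNzRingType) (f : R -> S) : Prop :=
  zmod_morphism f /\ monoid_morphism f.

(* B[U] contains iota(B) because U is nonempty. *)
Definition extends (B F B' F' : fieldType) (iota : {rmorphism B -> F})
    (iota' : {rmorphism B' -> F'}) (varphi : {rmorphism B -> B'})
    (U : set F) (V : set F') (U0 : U !=set0) (V0 : V !=set0)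
    (phi : polySpace iota U0 -> polySpace iota' V0) : Prop :=
  forall (c : B) (x : polySpace iota U0),
    val x = iota c -> val (phi x) = iota' (varphi c).

(* Main.v *)
Require Import Defs.
From HB Require Import structures.
From mathcomp Require Import all_boot all_order all_algebra.
From mathcomp Require Import boolp classical_sets.
From mathcomp Require Import mpoly.
Import GRing.Theory.
Local Open Scope classical_set_scope.
Local Open Scope ring_scope.

(** Both sides of the equivalence say that [phi] commutes with the evaluation
    of polynomials: [phi (p(a)) = p^varphi (phi(a))] for every polynomial [p]
    over [B] in at least one variable and every tuple [a] in [B[U]].  This
    middle property is [preserves_polys].

    A ring homomorphism extending [varphi] has it because [p(a)] is a finite
    sum of monomials in the [a i] with coefficients in the image of [B]
    ([preserves_polys_ring_hom]); conversely the polynomials [X_0 - X_1],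
    [X_0 * X_1] and the constants give back the homomorphism laws and the
    compatibility with [varphi] ([ring_hom_preserves_polys]).

    A [theta]-morphism speaks of functions instead of polynomials, and several
    polynomials may induce the same function when [F] is finite.  This is
    harmless: if [p] and [q] both induce [f], then [p^varphi (phi(a))] and
    [q^varphi (phi(a))] are both equal to [phi (f(a))] as soon as [phi]
    preserves polynomials, so that [theta(f)(phi(a))] is well-defined on the
    image of [phi]; conversely well-definedness lets any representative of [f]
    be used to compute it ([theta_morphismE]). *)

Lemma app_cast_id {D : Type} (g : operator D) (e : arity g = arity g)
    (b : 'I_(arity g) -> D) : app_cast e b = g b.
Proof. by congr (@opfun _ _ _); apply/funext => i; rewrite cast_ord_id. Qed.

Section PolynomialPreservation.
Context {B F B' F' : fieldType}.
Context {iota : {rmorphism B -> F}} {iota' : {rmorphism B' -> F'}}.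
Context {varphi : {rmorphism B -> B'}}.

Lemma polyOps_tau {n : nat} (n0 : (0 < n)%N) (p : {mpoly B[n]}) :
  gsops (polyOps iota) (tau iota n0 p).
Proof. by exists n, n0, p. Qed.

Lemma mmap_vartheta {n : nat} (b : 'I_n -> F') (p : {mpoly B[n]}) :
  mmap iota' b (vartheta varphi p) = mmap (iota' \o varphi) b p.
Proof.
rewrite /vartheta /map_mpoly [X in mmap iota' b X]/mmap rmorph_sum /=.
rewrite [RHS]/mmap; apply: eq_bigr => m _.
rewrite rmorphM /= mmapC; congr (_ * _).
rewrite /mmap1 rmorph_prod; apply: eq_bigr => i _.
by rewrite rmorphXn /= mmapX mmap1U.
Qed.

Context {U : set F} {V : set F'} {U0 : U !=set0} {V0 : V !=set0}.
Implicit Type phi : polySpace iota U0 -> polySpace iota' V0.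

(** The value [p(a)] is named by an element [x] of [B[U]] known only through
    its value in [F], so that it can be taken to be any expression of the
    ring [B[U]], without transport of membership proofs. *)
Definition preserves_polys phi : Prop :=
  forall (n : nat) (p : {mpoly B[n]}) (a : 'I_n -> polySpace iota U0)
    (x : polySpace iota U0), (0 < n)%N ->
  val x = mmap iota (fun i => val (a i)) p ->
  val (phi x) = mmap (iota' \o varphi) (fun i => val (phi (a i))) p.

Lemma theta_morphismE phi :
  theta_morphism (theta iota iota' varphi) phi <-> preserves_polys phi.
Proof.
split=> [phiM n p a x n0 xE | phiP f Tf a fD b].
  have fg : relset (theta iota iota' varphi)
      (tau iota n0 p, tau iota' n0 (vartheta varphi p)) by exists n, n0, p.
  have fD : Dom (theta iota iota' varphi) (tau iota n0 p) by eexists; exact: fg.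
  have [[_ wd] [g [e [fg' ve]]]] := phiM _ (polyOps_tau n0 p) a fD.
  have -> : x = tact (polyOps_tau n0 p) a by apply: val_inj.
  by rewrite -ve (wd _ (tau iota' n0 (vartheta varphi p)) e erefl fg' fg) app_cast_id /= mmap_vartheta.
(* All related [g] take the value [phi (f(a))], whatever polynomial they are
   induced by; this settles uniqueness and existence of theta(f)(b) at once. *)
have val_rel g : relset (theta iota iota' varphi) (f, g) -> arity g = arity f /\
    forall e : arity g = arity f,
      app_cast e b = val (phi (tact Tf a)).
  move=> [n [n0 [p [ef ->]]]]; rewrite ef in Tf a b fD *.
  split=> // e; rewrite app_cast_id /= mmap_vartheta.
  by apply/esym/(phiP _ _ _ _ n0).
split; first split.
- by move=> g /val_rel[].
- by move=> g g' e e' /val_rel[_ ->] /val_rel[_ ->].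
- by have [g fg] := fD; have [e ve] := val_rel _ fg; exists g, e.
Qed.

Lemma polySpace_const (c : B) : {x : polySpace iota U0 | val x = iota c}.
Proof.
exists (tact (polyOps_tau (ltn0Sn 0) c%:MP) (fun=> 0 : polySpace iota U0)).
by rewrite /= mmapC.
Qed.

Lemma preserves_polys_ring_hom phi :
  ring_hom phi -> extends varphi phi -> preserves_polys phi.
Proof.
move=> [phiB phiM] phiC n p a x _ xE.
pose phi_add := GRing.isZmodMorphism.Build _ _ phi phiB.
pose phi_mul := GRing.isMonoidMorphism.Build _ _ phi phiM.
pose h : {rmorphism polySpace iota U0 -> polySpace iota' V0} :=
  HB.pack phi phi_add phi_mul.
pose C c := sval (polySpace_const c).
have valC c : val (C c) = iota c := svalP (polySpace_const c).
(* Write [p(a)] inside the ring [B[U]], where [phi] can be distributed. *)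
have -> : x = \sum_(m <- msupp p) C p@_m * \prod_i a i ^+ m i.
  apply: val_inj; rewrite xE rmorph_sum; apply: eq_bigr => m _.
  rewrite rmorphM rmorph_prod; congr (_ * _); first exact/esym/valC.
  by apply: eq_bigr => i _; rewrite rmorphXn.
rewrite -[phi]/(h : _ -> _) !rmorph_sum; apply: eq_bigr => m _.
rewrite !rmorphM !rmorph_prod; congr (_ * _); first exact/phiC/valC.
by apply: eq_bigr => i _; rewrite !rmorphXn.
Qed.

Lemma ring_hom_preserves_polys phi :
  preserves_polys phi -> ring_hom phi /\ extends varphi phi.
Proof.
move=> phiP.
have phiC : extends varphi phi.
  move=> c x xE.
  by rewrite (phiP 1 c%:MP (fun=> 0) x) ?mmapC.
pose pair x y (i : 'I_2) : polySpace iota U0 := if val i == 0%N then x else y.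
split=> //; split=> [x y|]; last split=> [|x y]; apply: val_inj.
- rewrite (phiP 2 ('X_0 - 'X_1) (pair x y)) //.
    by rewrite mmapB !mmapX !mmap1U rmorphB.
  by rewrite mmapB !mmapX !mmap1U rmorphB.
- by rewrite (phiC 1) ?rmorph1.
- rewrite (phiP 2 ('X_0 * 'X_1) (pair x y)) //.
    by rewrite [LHS]rmorphM /= !mmapX !mmap1U.
  by rewrite [RHS]rmorphM /= !mmapX !mmap1U.
Qed.

End PolynomialPreservation.

Theorem proposition8p5p7 (B F B' F' : fieldType)
    (iota : {rmorphism B -> F}) (iota' : {rmorphism B' -> F'})
    (varphi : {rmorphism B -> B'}) (varphi_bij : bijective varphi)
    (U : set F) (V : set F') (U0 : U !=set0) (V0 : V !=set0)
    (phi : polySpace iota U0 -> polySpace iota' V0) :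
  ring_hom phi /\ extends varphi phi <->
  theta_morphism (theta iota iota' varphi) phi.
Proof.
rewrite theta_morphismE; split; last exact: ring_hom_preserves_polys.
by case; exact: preserves_polys_ring_hom.
Qed.
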